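(* Let $K$ be a field, $S=K[x_1,\dots,x_n]$, and let $I\subseteq S$ be a left PLP-polymatroidal ideal with data $k$, $d$, $b_1,\dots,b_k$, $\alpha_{k+1},\dots,\alpha_n$, $\beta_{k+1},\dots,\beta_n$. Then $$\operatorname{depth} S/I=|\{\,i:\ k+1\le i\le n-1,\ \alpha_i=\beta_i\}|.$$
   Context: Left PLP-polymatroidal ideal: let $n,k,d$ be positive integers with $1\le k\le n-1$, let $b_1,\dots,b_k$ be positive integers and let $\alpha_i,\beta_i$ $(k+1\le i\le n)$ be non-negative integers with $\alpha_i\le\beta_i$ for all $i$, $\alpha_{k+1}\le\cdots\le\alpha_n=d$ and $\beta_{k+1}\le\cdots\le\beta_n=d$. The corresponding left PLP-polymatroidal ideal $I$ is the monomial ideal of $S$ generated by all $x_1^{u_1}\cdots x_n^{u_n}$, with $u_i$ non-negative integers, such that $0\le u_i\le b_i$ for $1\le i\le k$ and $\alpha_i\le u_1+\cdots+u_i\le\beta_i$ for $i=k+1,\dots,n$.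
   Formalization: The formal theorem adds the hypothesis β_{k+1} > 0; without it the formula fails (e.g. n=3, k=1, α_2=β_2=0, α_3=β_3=d gives I=(x_3^d) of depth 2, but the count is 1), and it fails in every case with β_{k+1} = 0. *)

(* Defs.v *)
From mathcomp Require Import all_boot all_algebra.
From mathcomp Require Export mpoly.

Set Implicit Arguments.
Unset Strict Implicit.
Unset Printing Implicit Defensive.

Import GRing.Theory.
Local Open Scope ring_scope.

Section Depth.
Variable R : comNzRingType.
Implicit Types (A I J : R -> Prop) (s : seq R).

Definition ideal_gen A : R -> Prop := fun f =>
  exists (m : nat) (c a : 'I_m -> R),
    (forall i, A (a i)) /\ f = \sum_(i < m) c i * a i.

(* The ideal I + (s). *)
Definition ideal_add I s : R -> Prop :=
  ideal_gen (fun f => I f \/ f \in s).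

(* With M = R/I and s = f_1, ..., f_r, the module M/(f_1,...,f_j)M is
   R/(I + (f_1,...,f_j)); so multiplication by f_{j+1} is injective on it iff
   f_{j+1} g \in I + (f_1,...,f_j) implies g \in I + (f_1,...,f_j), and
   M <> (s)M iff 1 \notin I + (s). *)
Definition regular_on_quotient I s : Prop :=
  (forall j, (j < size s)%N -> forall g,
     ideal_add I (take j s) (s`_j * g) -> ideal_add I (take j s) g)
  /\ ~ ideal_add I s 1.

(* depth_quotient J I r: the R-module R/I has depth r with respect to J, i.e.
   r is the maximal length of an R/I-regular sequence of elements of J. *)
Definition depth_quotient J I (r : nat) : Prop :=
  (exists s, [/\ forall f, f \in s -> J f, regular_on_quotient I s
              & size s = r])
  /\ (forall s, (forall f, f \in s -> J f) -> regular_on_quotient I s ->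
        (size s <= r)%N).

End Depth.

Definition irrelevant_ideal (K : fieldType) (n : nat) : {mpoly K[n]} -> Prop :=
  ideal_gen (fun f => exists i : 'I_n, f = 'X_i).

(* The depth of S/I over S = K[x_1,...,x_n]. *)
Definition depth_is (K : fieldType) (n : nat) (I : {mpoly K[n]} -> Prop)
    (r : nat) : Prop :=
  depth_quotient (@irrelevant_ideal K n) I r.

(* Indices of b, alpha and beta are 1-based, as on paper: b is only used on
   1..k and alpha, beta only on k+1..n.  The variable x_i is 'X_j for
   the j : 'I_n of value i - 1. *)
Record left_plp_data (n k d : nat) (b alpha beta : nat -> nat) : Prop :=
  LeftPlpData {
    plp_n_gt0 : (0 < n)%N;
    plp_d_gt0 : (0 < d)%N;
    plp_k_bounds : (1 <= k <= n - 1)%N;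
    plp_b_gt0 : forall i, (1 <= i <= k)%N -> (0 < b i)%N;
    plp_alpha_le_beta : forall i, (k + 1 <= i <= n)%N ->
      (alpha i <= beta i)%N;
    plp_alpha_mono : forall i, (k + 1 <= i < n)%N ->
      (alpha i <= alpha i.+1)%N;
    plp_alpha_n : alpha n = d;
    plp_beta_mono : forall i, (k + 1 <= i < n)%N -> (beta i <= beta i.+1)%N;
    plp_beta_n : beta n = d
  }.

Definition left_plp_exponent (n k : nat) (b alpha beta : nat -> nat)
    (u : 'X_{1..n}) : Prop :=
  (forall j : 'I_n, (j < k)%N -> (u j <= b j.+1)%N)
  /\ (forall i, (k + 1 <= i <= n)%N ->
        (alpha i <= \sum_(j < n | (j < i)%N) u j <= beta i)%N).

(* The data allow beta (k + 1) = 0; then x_1, ..., x_{k+1} do not occur in the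
   ideal, and the depth of S/I is k more than the number of i in k+1..n-1 with
   alpha i = beta i.  For n = 3, k = 1, alpha 2 = beta 2 = 0 the ideal is
   (x_3^d), of depth 2, while that number is 1.  The depth formula therefore
   needs the separate hypothesis 0 < beta (k + 1). *)
Definition left_plp_ideal (K : fieldType) (n k : nat)
    (b alpha beta : nat -> nat) : {mpoly K[n]} -> Prop :=
  ideal_gen (fun f => exists u : 'X_{1..n},
    left_plp_exponent k b alpha beta u /\ f = 'X_[u]).

(* Main.v *)
(* Call i tight if k+1 <= i <= n-1 and alpha_i = beta_i.  At a tight t the
   condition on u splits into one on x_1..x_t and one on x_(t+1)..x_n, so I is
   an intersection of two monomial ideals in disjoint sets of variables and
   x_t - x_(t+1) is a nonzerodivisor on S/I.  Setting x_t = x_(t+1) leaves a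
   monomial ideal that still splits at every larger tight index, so the linear
   forms x_t - x_(t+1), t tight, are a regular sequence.  Modulo these forms a
   monomial depends only on its partial degrees at the non-tight indices.  The
   monomial w with partial degrees 0 up to k, min(alpha_j, d-1) for j > k, has
   degree d-1, hence is nonzero in the quotient, while each x_i w is congruent
   to a generator of I; so the quotient has a nonzero socle.

   That no regular sequence in the maximal ideal is longer is the invariance of
   grade, proved without Noetherian hypotheses by exchanging elements against a
   generic one over R[t]. *)
Require Import Defs.
From mathcomp Require Import all_boot all_algebra ring zify.
From Stdlib Require Import Classical FunctionalExtensionality PropExtensionality.

Set Implicit Arguments.
Unset Strict Implicit.
Unset Printing Implicit Defensive.

Import GRing.Theory.
Local Open Scope ring_scope.

(** * Regular sequences *)

Lemma pred_ext (T : Type) (P Q : T -> Prop) : (forall x, P x <-> Q x) -> P = Q.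
Proof.
by move=> PQ; apply: functional_extensionality => x; apply: propositional_extensionality.
Qed.

Section Ideals.
Variable R : comNzRingType.
Implicit Types (I J A : R -> Prop) (s : seq R) (a b c f g h : R).

Definition is_ideal I :=
  [/\ I 0, forall a b, I a -> I b -> I (a + b) & forall c a, I a -> I (c * a)].

Lemma is_idealB I a b : is_ideal I -> I a -> I b -> I (a - b).
Proof. by case=> _ ID IM Ia Ib; apply: ID => //; rewrite -mulN1r; apply: IM. Qed.

Lemma is_ideal_subr I a b : is_ideal I -> I (a - b) -> I b -> I a.
Proof. by case=> _ ID _ Iab Ib; rewrite -(subrK b a); apply: ID. Qed.

Lemma is_ideal_sum I (T : Type) (r : seq T) (P : pred T) (F : T -> R) :
  is_ideal I -> (forall i, P i -> I (F i)) -> I (\sum_(i <- r | P i) F i).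
Proof. by case=> I0 ID _ IF; apply: (big_ind I). Qed.

Lemma is_ideal_sum_seq I (T : eqType) (r : seq T) (F : T -> R) :
  is_ideal I -> (forall i, i \in r -> I (F i)) -> I (\sum_(i <- r) F i).
Proof. by move=> hI IF; rewrite big_seq; apply: is_ideal_sum. Qed.

Lemma ideal_gen_sub A I f :
  is_ideal I -> (forall a, A a -> I a) -> ideal_gen A f -> I f.
Proof.
move=> hI AI [m [c [a [Aa ->]]]]; apply: is_ideal_sum => // i _.
by case: hI => _ _; apply; apply: AI.
Qed.

Lemma ideal_gen_mem A a : A a -> ideal_gen A a.
Proof.
move=> Aa; exists 1%N, (fun=> 1), (fun=> a); split=> //.
by rewrite big_ord1 mul1r.
Qed.

Lemma ideal_gen_ideal A : is_ideal (ideal_gen A).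
Proof.
split.
- by exists 0%N, (fun=> 0), (fun=> 0); split=> [[]|]; rewrite ?big_ord0.
- move=> f g [m [c [a [Aa ->]]]] [m' [c' [a' [Aa' ->]]]].
  exists (m + m')%N.
  exists (fun i => match split i with inl j => c j | inr j => c' j end).
  exists (fun i => match split i with inl j => a j | inr j => a' j end).
  split=> [i|]; first by case: split.
  rewrite big_split_ord /=; congr (_ + _); apply: eq_bigr => i _.
    by rewrite (unsplitK (inl i)).
  by rewrite (unsplitK (inr i)).
- move=> c0 f [m [c [a [Aa ->]]]]; exists m, (fun i => c0 * c i), a; split=> //.
  by rewrite mulr_sumr; apply: eq_bigr => i _; rewrite mulrA.
Qed.

(** For an ideal [I] this is I + (a). Membership is carried by one coefficient, so adjoining a
    sequence is a fold and the sums of [ideal_gen] are avoided. *)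
Definition adj I a : R -> Prop := fun f => exists c, I (f - c * a).

Definition adjs I s := foldl adj I s.

Lemma adj_ideal I a : is_ideal I -> is_ideal (adj I a).
Proof.
case=> I0 ID IM; split.
- by exists 0; rewrite mul0r subr0.
- move=> f g [c Ic] [c' Ic']; exists (c + c').
  have -> : f + g - (c + c') * a = (f - c * a) + (g - c' * a) by ring.
  exact: ID.
- move=> b f [c Ic]; exists (b * c).
  have -> : b * f - b * c * a = b * (f - c * a) by ring.
  exact: IM.
Qed.

Lemma adj_sub I a f : I f -> adj I a f.
Proof. by move=> If; exists 0; rewrite mul0r subr0. Qed.

Lemma adj_mem I a : is_ideal I -> adj I a a.
Proof. by case=> I0 _ _; exists 1; rewrite mul1r subrr. Qed.

Lemma adjs_ideal I s : is_ideal I -> is_ideal (adjs I s).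
Proof. by elim: s I => //= a s IH I hI; apply: IH; apply: adj_ideal. Qed.

Lemma adjs_rcons I s a : adjs I (rcons s a) = adj (adjs I s) a.
Proof. by rewrite /adjs foldl_rcons. Qed.

Lemma adjs_sub I s f : I f -> adjs I s f.
Proof. by elim: s I => //= a s IH I If; apply: IH; apply: adj_sub. Qed.

Lemma adjs_mem I s f : is_ideal I -> f \in s -> adjs I s f.
Proof.
elim: s I => //= a s IH I hI; rewrite inE => /predU1P [-> | fs].
  by apply: adjs_sub; apply: adj_mem.
by apply: IH => //; apply: adj_ideal.
Qed.

Lemma adjC I a b : adj (adj I a) b = adj (adj I b) a.
Proof.
by apply: pred_ext => f; split=> -[c [d Id]]; exists d, c; move: Id; congr I; ring.
Qed.

Lemma adjs_adj I s a : adjs (adj I a) s = adj (adjs I s) a.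
Proof. by elim: s I => //= b s IH I; rewrite adjC IH. Qed.

Lemma ideal_addE I s : is_ideal I -> ideal_add I s = adjs I s.
Proof.
move=> hI; apply: pred_ext => f; split.
  apply: ideal_gen_sub; first exact: adjs_ideal.
  by move=> a [Ia | sa]; [apply: adjs_sub | apply: adjs_mem].
elim/last_ind: s f => [|s a IH] f.
  by move=> If; apply: ideal_gen_mem; left.
rewrite adjs_rcons => -[c] /IH Ifc.
apply: (is_ideal_subr (b := c * a) (ideal_gen_ideal _)); last first.
  have [_ _ IM] := ideal_gen_ideal (fun g => I g \/ g \in rcons s a).
  by apply: (IM c); apply: ideal_gen_mem; right; rewrite mem_rcons mem_head.
apply: ideal_gen_sub Ifc; first exact: ideal_gen_ideal.
move=> b [Ib | sb]; apply: ideal_gen_mem; first by left.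
by right; rewrite mem_rcons inE sb orbT.
Qed.

Definition nzd I a := forall g, I (a * g) -> I g.

Definition regular I s :=
  forall j, (j < size s)%N -> nzd (adjs I (take j s)) s`_j.

Lemma regular_cons I a s : nzd I a -> regular (adj I a) s -> regular I (a :: s).
Proof. by move=> Ia Is [|j] //= js; apply: Is. Qed.

Lemma regular_rcons I s a :
  regular I (rcons s a) -> regular I s /\ nzd (adjs I s) a.
Proof.
move=> Is; split=> [j js|].
  have := Is j; rewrite size_rcons nth_rcons js -cats1 takel_cat; last exact: ltnW.
  by apply; apply: ltnW.
have := Is (size s); rewrite size_rcons nth_rcons ltnn eqxx -cats1 take_size_cat //.
exact.
Qed.

Lemma regular_on_quotientE I s : is_ideal I ->
  regular_on_quotient I s <-> regular I s /\ ~ adjs I s 1.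
Proof.
move=> hI; rewrite /regular_on_quotient ideal_addE //.
by split=> -[Is I1]; split=> // j js g; have := Is j js g; rewrite ideal_addE.
Qed.

(** If [a * h] is [q * z] modulo [I], then [z * q] lies in I + (a), hence [q] is some [q' * a]
    modulo [I], and [a] cancels from [a * (h - q' * z)]. *)
Lemma nzd_adj_swap I a z : is_ideal I ->
  nzd I a -> nzd (adj I a) z -> nzd (adj I z) a.
Proof.
move=> hI Ia Iaz h [q Iq].
have [q' Iq'] : adj I a q.
  apply: Iaz; exists h; have -> : z * q - h * a = - 1 * (a * h - q * z) by ring.
  by case: hI => _ _; apply.
exists q'; apply: Ia; have -> : a * (h - q' * z) = (a * h - q * z) + z * (q - q' * a) by ring.
by case: hI => _ ID IM; apply: ID => //; apply: IM.
Qed.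

(** Modulo each initial segment of [s], the entry that follows is swapped with [z]. *)
Lemma regular_adj I s z : is_ideal I -> regular I s ->
  (forall j, (j <= size s)%N -> nzd (adjs I (take j s)) z) ->
  regular (adj I z) s.
Proof.
move=> hI Is Iz j js; rewrite adjs_adj; apply: nzd_adj_swap.
- exact: adjs_ideal.
- exact: Is.
- by rewrite -adjs_rcons -take_nth //; apply: Iz.
Qed.

(* Hom(R/J, R/(I + g)) and Hom(R/J, R/(I + z)) are both Ext^1(R/J, R/I). *)
Lemma socle_exchange I J g z w : is_ideal I -> J z -> nzd I g -> nzd I z ->
    ~ adj I g w -> (forall a, J a -> adj I g (a * w)) ->
  exists2 v, ~ adj I z v & forall a, J a -> adj I z (a * v).
Proof.
move=> hI Jz Ig Iz Iw Jw; case: (Jw z Jz) => v Iv.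
have [_ ID IM] := hI.
exists v => [[v' Iv']|a Ja].
  apply: Iw; exists v'; apply: Iz.
  have -> : z * (w - v' * g) = (z * w - v * g) + g * (v - v' * z) by ring.
  by apply: ID => //; apply: IM.
have [c Ic] := Jw a Ja; exists c; apply: Ig.
have -> : g * (a * v - c * z) = z * (a * w - c * g) - a * (z * w - v * g) by ring.
by apply: is_idealB => //; apply: IM.
Qed.

End Ideals.

(** * Extension of ideals to R[t] *)

Section Polynomials.
Variable R : comNzRingType.
Implicit Types (I J : R -> Prop) (s : seq R) (c : R).

(** For an ideal [I] this is the extended ideal I R[t]. *)
Definition coefs_in I : {poly R} -> Prop := fun p => forall i, I p`_i.

Lemma coefs_in_ideal I : is_ideal I -> is_ideal (coefs_in I).
Proof.
move=> hI; have [I0 ID IM] := hI; split=> [i|p q Ip Iq i|q p Ip i].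
- by rewrite coef0.
- by rewrite coefD; apply: ID.
- by rewrite coefM; apply: is_ideal_sum => // j _; apply: IM.
Qed.

Lemma coefs_inC I c : is_ideal I -> coefs_in I c%:P <-> I c.
Proof.
move=> [I0 _ _]; split=> [Ic | Ic i]; first by have := Ic 0%N; rewrite coefC.
by rewrite coefC; case: eqP.
Qed.

Lemma coefs_in_adj I c :
  is_ideal I -> adj (coefs_in I) c%:P = coefs_in (adj I c).
Proof.
move=> hI; apply: pred_ext => p; split=> [[q Iq] i | Ip].
  by exists q`_i; have := Iq i; rewrite coefB coefMC.
(* Witnesses are needed only below the size of [p], so they assemble into one polynomial. *)
have [d Id] := fin_all_exists (fun i : 'I_(size p) => Ip i).
exists (\poly_(i < size p) (if insub i is Some j then d j else 0)) => i.
rewrite coefB coefMC coef_poly; case: ltnP => pi.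
  by rewrite insubT; apply: (Id (Ordinal pi)).
by rewrite nth_default // mul0r subr0; case: hI.
Qed.

Lemma coefs_in_adjs I s :
  is_ideal I -> adjs (coefs_in I) (map polyC s) = coefs_in (adjs I s).
Proof.
elim: s I => //= a s IH I hI.
by rewrite coefs_in_adj // IH //; apply: adj_ideal.
Qed.

Lemma nzd_coefs_inC I c : nzd I c -> nzd (coefs_in I) c%:P.
Proof. by move=> Ic p Icp i; apply: Ic; have := Icp i; rewrite coefCM. Qed.

Lemma regular_coefs_in I s :
  is_ideal I -> regular I s -> regular (coefs_in I) (map polyC s).
Proof.
move=> hI Is j; rewrite size_map => js.
rewrite -map_take coefs_in_adjs // (nth_map 0) //.
by apply: nzd_coefs_inC; apply: Is.
Qed.

(* McCoy: z z' = 0 for some z' <> 0 forces a common annihilator of the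
   coefficients of z. *)
Lemma nzd_coefs_in I (z : {poly R}) j : is_ideal I -> nzd I z`_j -> nzd (coefs_in I) z.
Proof.
move=> hI Ij p; have [I0 ID IM] := hI; have [J0 JD JM] := coefs_in_ideal hI.
elim: {p}(size p) {-2}p (leqnn (size p)) => [|m IH] p.
  by rewrite leqn0 size_poly_eq0 => /eqP ->.
move=> pm Izp.
(* The coefficient of index [j] can then be cancelled. *)
suff Hp : forall i, coefs_in I (z`_i *: p).
  by move=> i; apply: Ij; have := Hp j i; rewrite coefZ.
(* Downward passage through the coefficients of [z]: once the one of index [l] is known to kill [p],
   it is dropped from the truncation of [z]. *)
have H l : coefs_in I (take_poly l z * p) ->
    forall i, (i < l)%N -> coefs_in I (z`_i *: p).
  elim: l => // l IHl Ilp.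
  have Il : coefs_in I (z`_l *: p).
    (* Removing the top term lowers the size, so the outer induction applies to [q]. *)
    pose q := z`_l *: (p - p`_m *: 'X^m).
    (* The coefficient of index [l + m] in the truncated product is this single product, as [p] has
       degree at most [m]. *)
    have Itop : I (z`_l * p`_m).
      have := Ilp (l + m)%N; rewrite coefM.
      rewrite (bigD1 (inord l)) //= inordK ?ltnS ?leq_addr // coef_take_poly ltnSn addKn.
      rewrite big1 ?addr0 // => i; rewrite -val_eqE /= inordK ?ltnS ?leq_addr // => il.
      rewrite coef_take_poly; case: ltnP => li; last by rewrite mul0r.
      rewrite [p`__]nth_default ?mulr0 //; apply: leq_trans pm _.
      by rewrite ltnS in li; lia.
    have Iq : coefs_in I q.
      apply: IH.
        apply/leq_sizeP => i mi; rewrite coefZ coefB coefZ coefXn.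
        have [-> | im] := eqVneq i m; first by rewrite mulr1 subrr mulr0.
        rewrite mulr0 subr0 [p`__]nth_default ?mulr0 //; apply: leq_trans pm _.
        by rewrite ltn_neqAle eq_sym im.
      have -> : z * q = (z`_l)%:P * (z * p) - (z * 'X^m) * (z`_l * p`_m)%:P.
        by rewrite /q -!mul_polyC polyCM; ring.
      apply: (is_idealB (coefs_in_ideal hI)); apply: JM => //.
      by apply/(coefs_inC _ hI).
    have -> : z`_l *: p = q + 'X^m * (z`_l * p`_m)%:P.
      by rewrite /q -!mul_polyC polyCM; ring.
    by apply: JD => //; apply: JM; apply/(coefs_inC _ hI).
  move=> i; rewrite ltnS leq_eqVlt => /predU1P [-> //|].
  apply: IHl.
  have -> : take_poly l z = take_poly l.+1 z - z`_l *: 'X^l.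
    apply/polyP => i'; rewrite coefB coefZ coefXn !coef_take_poly.
    case: (ltngtP i' l) => [il|il|->].
    - by rewrite ltnS (ltnW il) mulr0 subr0.
    - by rewrite ltnS leqNgt il mulr0 subr0.
    - by rewrite ltnSn mulr1 subrr.
  rewrite mulrBl; apply: (is_idealB (coefs_in_ideal hI)) => //.
  by rewrite -!scalerAl scalerAr; apply: JM.
move=> i; have [iz | zi] := ltnP i (size z).
  by apply: (H (size z)) => //; rewrite take_poly_id.
by rewrite nth_default // scale0r.
Qed.

End Polynomials.

(* Over R[t] the generic combination z of f and g is a nonzerodivisor wherever
   some entry of f or g is one; exchanging the last entries of f and g for z
   and dividing out by z shortens both sequences. *)
Lemma regular_size_le r (R : comNzRingType) (I J : R -> Prop) (f g : seq R) w :
    is_ideal I -> J 0 ->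
    (forall a, a \in f -> J a) -> (forall a, a \in g -> J a) ->
    regular I f -> regular I g -> size g = r ->
    ~ adjs I g w -> (forall a, J a -> adjs I g (a * w)) ->
  (size f <= r)%N.
Proof.
elim: r => [|r IH] in R I J f g w * => hI J0 Jf Jg If Ig gr Iw Jw.
  (* With [g] empty, a first entry [a] of [f] is a nonzerodivisor with [a * w] in [I], which would
     put [w] in [I]. *)
  move/size0nil: gr Iw Jw => -> Iw Jw; case: f Jf If => // a f Jf If.
  by case: Iw; apply: (If 0%N) => //; apply: Jw; apply: Jf; rewrite mem_head.
case/lastP: f => [//|f fl] in Jf If *.
case/lastP: g => [//|g gl] in Jg Ig gr Iw Jw *.
have hIg := adjs_ideal g hI.
have [If1 Ifl] := regular_rcons If; have [Ig1 Igl] := regular_rcons Ig.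
rewrite !size_rcons in gr *; case: gr => gr.
(* All entries of both sequences become coefficients of [z], so modulo any proper initial segment of
   either one some coefficient is a nonzerodivisor. *)
pose s := rcons f fl ++ rcons g gl; pose z := Poly s.
have zs i : z`_i = s`_i by rewrite coef_Poly.
have Jz : coefs_in J z.
  move=> i; rewrite zs; have [is_|?] := ltnP i (size s); last by rewrite nth_default.
  by have := mem_nth 0 is_; rewrite mem_cat => /orP [/Jf|/Jg].
have nzd_z I' a : is_ideal I' -> a \in s -> nzd I' a -> nzd (coefs_in I') z.
  by move=> hI' /(nthP 0) [j _ <-]; rewrite -zs; apply: nzd_coefs_in.
have nzd_z_take t a : {subset rcons t a <= s} -> regular I (rcons t a) ->
    forall j, (j <= size (map polyC t))%N ->
    nzd (adjs (coefs_in I) (take j (map polyC t))) z.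
  move=> ts It j; rewrite size_map => jt.
  rewrite -map_take coefs_in_adjs //.
  apply: (nzd_z _ (rcons t a)`_j); first exact: adjs_ideal.
    by apply: ts; apply: mem_nth; rewrite size_rcons ltnS.
  have := It j; rewrite size_rcons ltnS jt -cats1 takel_cat //.
  exact.
have hIt := coefs_in_ideal hI.
have sf : {subset rcons f fl <= s} by move=> x xf; rewrite mem_cat xf.
have sg : {subset rcons g gl <= s} by move=> x xg; rewrite mem_cat xg orbT.
(* The last entry [gl] is traded for [z], and [w] for an element [v] killed by the extension of [J]
   modulo [g] and [z]. *)
have [v Iv Jv] : exists2 v, ~ adj (adjs (coefs_in I) (map polyC g)) z v
    & forall a, coefs_in J a -> adj (adjs (coefs_in I) (map polyC g)) z (a * v).
  apply: (socle_exchange (g := gl%:P) (w := w%:P)) => //.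
  - exact: adjs_ideal.
  - by rewrite coefs_in_adjs //; apply: nzd_coefs_inC.
  - by rewrite -{1}(take_size (map polyC g)); apply: (nzd_z_take g gl).
  - rewrite coefs_in_adjs // coefs_in_adj // coefs_inC; last exact: adj_ideal.
    by rewrite -adjs_rcons.
  - move=> a Ja; rewrite coefs_in_adjs // coefs_in_adj // -adjs_rcons => i.
    by rewrite coefMC; apply: Jw.
rewrite ltnS -(size_map polyC f).
apply: (IH _ (adj (coefs_in I) z) (coefs_in J) _ (map polyC g) v).
- exact: adj_ideal.
- by move=> i; rewrite coef0.
- move=> _ /mapP [a fa ->] i; rewrite coefC; case: eqP => // _.
  by apply: Jf; rewrite mem_rcons inE fa orbT.
- move=> _ /mapP [a ga ->] i; rewrite coefC; case: eqP => // _.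
  by apply: Jg; rewrite mem_rcons inE ga orbT.
- by apply: regular_adj => //; [apply: regular_coefs_in | apply: (nzd_z_take f fl)].
- by apply: regular_adj => //; [apply: regular_coefs_in | apply: (nzd_z_take g gl)].
- by rewrite size_map.
- by rewrite adjs_adj.
- by rewrite adjs_adj.
Qed.

Lemma is_ideal_congrM (R : comNzRingType) (Q : R -> Prop) a b c d :
  is_ideal Q -> Q (a - b) -> Q (c - d) -> Q (a * c - b * d).
Proof.
move=> [_ QD QM] Qab Qcd.
have -> : a * c - b * d = c * (a - b) + b * (c - d) by ring.
by apply: QD; apply: QM.
Qed.

Lemma is_ideal_congrX (R : comNzRingType) (Q : R -> Prop) a b k :
  is_ideal Q -> Q (a - b) -> Q (a ^+ k - b ^+ k).
Proof.
move=> hQ Qab; elim: k => [|k IH]; first by rewrite subrr; case: hQ.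
by rewrite !exprS; apply: is_ideal_congrM.
Qed.

(** Adjoining elements fixed by the idempotent [tau] commutes with taking preimages under [tau], so
    each nonzerodivisor condition pulls back. *)
Lemma regular_preim (R : comNzRingType) (tau : {rmorphism R -> R})
    (J : R -> Prop) s :
    is_ideal J -> (forall p, tau (tau p) = tau p) ->
    (forall p, J p -> J (tau p)) -> (forall a, a \in s -> tau a = a) ->
  regular J s -> regular (fun p => J (tau p)) s.
Proof.
move=> hJ tauK Jtau taus Js j js.
have -> : adjs (fun p => J (tau p)) (take j s) = fun p => adjs J (take j s) (tau p).
  have {Js js} : forall a, a \in take j s -> tau a = a.
    by move=> a /mem_take; apply: taus.
  elim: (take j s) J hJ Jtau => //= a u IH J hJ Jtau tauu.
  have taua : tau a = a by apply: tauu; rewrite mem_head.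
  rewrite -IH; last 1 first.
  - by move=> b bu; apply: tauu; rewrite inE bu orbT.
  - congr adjs; apply: pred_ext => p; split=> -[c Jc].
      by exists (tau c); move: Jc; rewrite rmorphB rmorphM taua.
    exists c; have := Jtau _ Jc; rewrite !rmorphB !rmorphM taua tauK.
    exact.
  - exact: adj_ideal.
  - by move=> p [c Jc]; exists (tau c); have := Jtau _ Jc; rewrite rmorphB rmorphM taua.
move=> g; rewrite rmorphM taus; last exact: mem_nth.
exact: Js.
Qed.

(** * Monomial ideals and gluing of variables *)

Section MonomialIdeals.
Variables (K : fieldType) (n : nat).
Implicit Types (L : 'X_{1..n} -> Prop) (m : 'X_{1..n}) (p q : {mpoly K[n]}).

(** For an upset [L] this is the monomial ideal with exponent set [L], described by supports so that
    membership is tested one coefficient at a time. *)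
Definition monideal L p := forall m, p@_m != 0 -> L m.

Definition upset L := forall m m', L m -> L (m + m')%MM.

Definition up L m := exists2 u, L u & (u <= m)%MM.

Lemma upset_up L : upset (up L).
Proof.
move=> m m' [u Lu um]; exists u => //; apply/mnm_lepP => i.
by rewrite mnmDE (leq_trans (mnm_lepP um i)) ?leq_addr.
Qed.

Lemma upset_le L m m' : upset L -> L m -> (m <= m')%MM -> L m'.
Proof. by move=> hL Lm mm'; rewrite -(submK mm') addmC; apply: hL. Qed.

Lemma monideal_ideal L : upset L -> is_ideal (monideal L).
Proof.
move=> hL; split=> [m|p q Lp Lq m|c p Lp m].
- by rewrite mcoeff0 eqxx.
- rewrite mcoeffD; have [-> | p0 _] := eqVneq p@_m 0; last exact: Lp.
  by rewrite add0r; apply: Lq.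
- rewrite -mcoeff_msupp => /msuppM_le /allpairsP [[m1 m2] /= [_ m2p ->]].
  by rewrite addmC; apply: hL; apply: Lp; rewrite -mcoeff_msupp.
Qed.

Lemma monidealX L m : monideal L 'X_[m] <-> L m.
Proof.
split=> [|Lm k]; first by apply; rewrite mcoeffX eqxx oner_eq0.
by rewrite mcoeffX; case: (m =P k) => [<- //|]; rewrite eqxx.
Qed.

Lemma monideal_sub L (I : {mpoly K[n]} -> Prop) p :
  is_ideal I -> (forall m, L m -> I 'X_[m]) -> monideal L p -> I p.
Proof.
move=> hI LI Lp; rewrite (mpolyE p); apply: is_ideal_sum_seq => // m mp.
rewrite -mul_mpolyC; case: hI => _ _; apply; apply: LI; apply: Lp.
by rewrite -mcoeff_msupp.
Qed.

Lemma ideal_gen_monomial L :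
  ideal_gen (fun f => exists u, L u /\ f = 'X_[K, u]) = monideal (up L).
Proof.
apply: pred_ext => p; split.
  apply: ideal_gen_sub; first exact: monideal_ideal (@upset_up L).
  by move=> _ [u [Lu ->]]; apply/monidealX; exists u => //; apply: lepm_refl.
apply: monideal_sub; first exact: ideal_gen_ideal.
move=> m [u Lu um]; rewrite -(submK um) mpolyXD.
have [_ _] := ideal_gen_ideal (fun f => exists u, L u /\ f = 'X_[K, u]).
by apply; apply: ideal_gen_mem; exists u.
Qed.

Lemma mcoeffMXU p a m :
  ('X_a * p)@_m = if m a == 0%N then 0 else p@_(m - U_(a)).
Proof.
rewrite mulrC; case: eqP => [ma | /eqP ma].
  apply: memN_msupp_eq0; rewrite (perm_mem (msuppMX _ _)).
  apply/mapP => -[m' _ mE]; move: ma; rewrite mE mnmDE mnm1E eqxx.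
  by rewrite addSn.
have am : (U_(a) <= m)%MM.
  by apply/mnm_lepP => i; rewrite mnm1E; case: eqP => // <-; rewrite lt0n.
by rewrite -{1}(submK am) addmC mcoeffMX.
Qed.

(** The coefficient at [m + U_(b)] is that of [p] at [m + U_(b) - U_(a)] minus that at [m]. Repeated
    moves lower the exponent of [a] to 0, where the first term is absent. *)
Lemma mcoeff_eq0_along_line (N : 'X_{1..n} -> Prop) a b p m : a != b ->
    (forall m, N m -> (('X_a - 'X_b) * p)@_(m + U_(b)) = 0) ->
    (forall m, N m -> (0 < m a)%N -> N (m + U_(b) - U_(a))%MM) ->
  N m -> p@_m = 0.
Proof.
move=> ab N0 Nline.
elim: {m}(m a) {-2}m (erefl (m a)) => [|k IH] m mk Nm.
all: have := N0 m Nm; rewrite mulrBl mcoeffB !mcoeffMXU !mnmDE !mnm1E eqxx.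
all: rewrite addn1 /= addmK [b == a]eq_sym (negbTE ab) addn0 mk /=.
  by move/eqP; rewrite sub0r oppr_eq0 => /eqP.
rewrite IH ?sub0r; first by move/eqP; rewrite oppr_eq0 => /eqP.
  by rewrite mnmBE mnmDE !mnm1E eqxx eq_sym (negbTE ab) addn0 mk subn1.
by apply: Nline => //; rewrite mk.
Qed.

Definition mix t m1 m2 := [multinom (if (i < t)%N then m1 i else m2 i) | i < n].

Definition split_at t L := forall m1 m2, L m1 -> L m2 -> L (mix t m1 m2).

Lemma mixE t m1 m2 i : mix t m1 m2 i = if (i < t)%N then m1 i else m2 i.
Proof. exact: mnmE. Qed.

(* L splits at t iff it is the intersection of an upset depending only on the
   variables before t and one depending only on the others; x_a - x_b is a
   nonzerodivisor modulo each of the two. *)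
Lemma nzd_monideal L t (a b : 'I_n) : upset L -> split_at t L ->
  (a < t <= b)%N -> nzd (monideal L) ('X_a - 'X_b).
Proof.
move=> hL Lt /andP [ta tb] p Lp m pm; apply: NNPP => Lm.
have ab : a != b by apply: contraTneq ta => ->; rewrite -leqNgt.
have bt : (b < t)%N = false by rewrite ltnNge tb.
(* If the part of [m] before [t] has no completion in [L], this persists along the line: raising [b]
   leaves that part alone, and lowering [a] keeps it outside the upset. *)
have [[m1 L1]|N1] := classic (exists m', L (mix t m m')); last first.
  case/eqP: pm; apply: (mcoeff_eq0_along_line
    (N := fun m => ~ exists m', L (mix t m m')) ab) => // {N1 Lm}m Nm.
    apply/eqP/negPn/negP => /Lp Lm; case: Nm; exists (m + U_(b))%MM.
    have -> // : mix t m (m + U_(b)) = (m + U_(b))%MM.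
    apply/mnmP => i; rewrite mixE mnmDE mnm1E; case: ifP => // it.
    by case: eqP it => [<-|]; rewrite ?bt ?addn0.
  move=> ma [m' Lm']; case: Nm; exists m'.
  apply: upset_le hL Lm' _; apply/mnm_lepP => i.
  rewrite !mixE; case: ifP => // it; rewrite mnmBE mnmDE !mnm1E.
  by case: eqP it => [<-|]; rewrite ?bt ?addn0 ?leq_subr.
have [[m2 L2]|N2] := classic (exists m', L (mix t m' m)).
  (* Both parts of [m] have completions in [L], and splitting joins them to [m] itself. *)
  case: Lm; suff <- : mix t (mix t m m1) (mix t m2 m) = m by apply: Lt.
  by apply/mnmP => i; rewrite !mixE; case: (i < t)%N.
(* The same argument for the part from [t] on, with [a] and [b] exchanged. *)
rewrite eq_sym in ab.
case/eqP: pm; apply: (mcoeff_eq0_along_line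
    (N := fun m => ~ exists m', L (mix t m' m)) ab) => // {N2 L1 m1 Lm}m Nm.
  apply/eqP/negPn/negP => pm; case: Nm; exists (m + U_(a))%MM.
  have -> : mix t (m + U_(a)) m = (m + U_(a))%MM.
    apply/mnmP => i; rewrite mixE mnmDE mnm1E; case: ifP => // it.
    by case: eqP it => [<-|]; rewrite ?ta ?addn0.
  by apply: Lp; rewrite -opprB mulNr mcoeffN oppr_eq0 in pm.
move=> mb [m' Lm']; case: Nm; exists m'.
apply: upset_le hL Lm' _; apply/mnm_lepP => i.
rewrite !mixE; case: ifP => // it; rewrite mnmBE mnmDE !mnm1E.
by case: eqP it => [<-|]; rewrite ?ta ?addn0 ?leq_subr.
Qed.

(** * Gluing variables along a map of indices *)

Definition push (h : 'I_n -> 'I_n) m :=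
  [multinom (\sum_(i | h i == j) m i)%N | j < n].

Lemma pushE h m j : push h m j = (\sum_(i | h i == j) m i)%N.
Proof. exact: mnmE. Qed.

Lemma push_id h m : (forall i, h (h i) = h i) -> push h (push h m) = push h m.
Proof.
move=> hK; apply/mnmP => j; rewrite !pushE.
rewrite [RHS](partition_big h (fun i => h i == j)) /= => [|i]; last by rewrite hK.
apply: eq_bigr => i /eqP hi; rewrite pushE; apply: eq_bigl => l.
by apply/idP/andP => [/eqP hl | []//]; rewrite -hi -hl hK.
Qed.

Lemma push_le h m m' : (m <= m')%MM -> (push h m <= push h m')%MM.
Proof.
move=> mm'; apply/mnm_lepP => j; rewrite !pushE; apply: leq_sum => i _.
exact: (mnm_lepP mm').
Qed.

Lemma push_mix (h : 'I_n -> 'I_n) t m1 m2 : (forall i, (h i < t)%N = (i < t)%N) ->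
  push h (mix t m1 m2) = mix t (push h m1) (push h m2).
Proof.
move=> ht; apply/mnmP => j; rewrite mixE !pushE.
case: ifP => jt; apply: eq_bigr => i /eqP hi; rewrite mixE.
  by rewrite -ht hi jt.
by rewrite -ht hi jt.
Qed.

Definition glue (h : 'I_n -> 'I_n) : {rmorphism {mpoly K[n]} -> {mpoly K[n]}} :=
  comp_mpoly [tuple 'X_(h i) | i < n].

Lemma glueXU h i : glue h 'X_i = 'X_(h i).
Proof. by rewrite /glue /= comp_mpolyXU -tnth_nth tnth_mktuple. Qed.

Lemma glueX h m : glue h 'X_[m] = 'X_[push h m].
Proof.
rewrite /glue /= comp_mpolyX [RHS]mpolyXE_id.
rewrite (partition_big h xpredT) //=; apply: eq_bigr => j _.
by rewrite pushE expr_sum; apply: eq_bigr => i /eqP <-; rewrite tnth_mktuple.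
Qed.

Lemma glueE h p : glue h p = \sum_(m <- msupp p) p@_m *: 'X_[push h m].
Proof. by rewrite /glue /= comp_mpolyEX; apply: eq_bigr => m _; rewrite -glueX. Qed.

Lemma glue_congr h (Q : {mpoly K[n]} -> Prop) p :
  is_ideal Q -> (forall i, Q ('X_i - 'X_(h i))) -> Q (p - glue h p).
Proof.
move=> hQ Qh; rewrite glueE {1}(mpolyE p) -sumrB; apply: is_ideal_sum => // m _.
rewrite -scalerBr -mul_mpolyC; case: (hQ) => Q0 _; apply.
rewrite -glueX /glue /= comp_mpolyX mpolyXE_id.
apply: (big_ind2 (fun a b => Q (a - b))) => [|a b c d|i _].
- by rewrite subrr.
- exact: is_ideal_congrM.
- by rewrite tnth_mktuple; apply: is_ideal_congrX.
Qed.

(** These exponents live on the image of [h], so in general they do not form an upset and [up] is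
    applied afterwards. *)
Definition pushed h L m := exists2 m', L m' & m = push h m'.

Lemma monideal_glue h L p :
  upset L -> monideal L p -> monideal (up (pushed h L)) (glue h p).
Proof.
move=> hL Lp; rewrite glueE; apply: is_ideal_sum_seq.
  exact: monideal_ideal (@upset_up _).
move=> m mp; rewrite -mul_mpolyC.
case: (monideal_ideal (@upset_up (pushed h L))) => _ _; apply.
apply/monidealX; exists (push h m); last exact: lepm_refl.
by exists m => //; apply: Lp; rewrite -mcoeff_msupp.
Qed.

(** Gluing kills ['X_a - 'X_b], and modulo this form every polynomial is congruent to its glued
    image. *)
Lemma adj_monideal_glue (a b : 'I_n) L : a != b -> upset L ->
  let h (i : 'I_n) := if i == a then b else i in
  adj (monideal L) ('X_a - 'X_b) = fun p => monideal (up (pushed h L)) (glue h p).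
Proof.
move=> ab hL h; have ha : h a = b by rewrite /h eqxx.
have hb : h b = b by rewrite /h eq_sym (negbTE ab).
have hI := adj_ideal ('X_a - 'X_b) (monideal_ideal hL).
have hh i : adj (monideal L) ('X_a - 'X_b) ('X_i - 'X_(h i)).
  rewrite /h; case: eqP => [->|_]; first exact: adj_mem (monideal_ideal hL).
  by rewrite subrr; case: hI.
apply: pred_ext => p; split=> [[c Lc] | Lp].
  have := monideal_glue (h := h) hL Lc.
  by rewrite rmorphB rmorphM rmorphB !glueXU ha hb subrr mulr0 subr0.
rewrite -(subrK (glue h p) p); case: (hI) => _ ID IM; apply: ID.
  exact: glue_congr.
apply: monideal_sub Lp => // m [_ [m' Lm' ->] mm'].
rewrite -(submK mm') mpolyXD; apply: (IM).
apply: (is_ideal_subr (b := 'X_[m'])) => //.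
  rewrite -glueX; have -> : glue h 'X_[m'] - 'X_[m'] = - 1 * ('X_[m'] - glue h 'X_[m']) by ring.
  by apply: IM; apply: glue_congr.
by apply: adj_sub; apply/monidealX.
Qed.

Lemma up_pushed_stable h L p : (forall i, h (h i) = h i) ->
  monideal (up (pushed h L)) p -> monideal (up (pushed h L)) (glue h p).
Proof.
move=> hK Lp; have := monideal_glue (h := h) (@upset_up _) Lp.
move=> H m /H [_ [m1 [_ [m' Lm' ->] m'u] ->] um].
exists (push h m'); first by exists m'.
by apply: lepm_trans um; rewrite -(push_id m' hK); apply: push_le.
Qed.

Lemma split_at_up_pushed (h : 'I_n -> 'I_n) t L : (forall i, (h i < t)%N = (i < t)%N) ->
  split_at t L -> split_at t (up (pushed h L)).
Proof.
move=> ht Lt e1 e2 [_ [m1 L1 ->] le1] [_ [m2 L2 ->] le2].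
exists (push h (mix t m1 m2)); first by exists (mix t m1 m2) => //; apply: Lt.
rewrite push_mix //; apply/mnm_lepP => i; rewrite !mixE.
by case: ifP => _; [apply: (mnm_lepP le1) | apply: (mnm_lepP le2)].
Qed.

End MonomialIdeals.

(** In 1-based numbering this is x_t - x_(t+1); the default of [inord] does not occur for 0 < t <=
    n. *)
Definition link (K : fieldType) n t : {mpoly K[n.+1]} :=
  'X_(inord t.-1) - 'X_(inord t).

Lemma regular_links (K : fieldType) n (L : 'X_{1..n.+1} -> Prop) (ts : seq nat) :
    upset L -> sorted ltn ts ->
    (forall t, t \in ts -> (0 < t <= n)%N /\ split_at t L) ->
  regular (@monideal K _ L) (map (@link K n) ts).
Proof.
elim: ts L => [|t ts IH] L hL sts Lts; first by case.
have [/andP [t0 tn] Lt] := Lts t (mem_head _ _).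
have va : (inord t.-1 : 'I_n.+1) = t.-1 :> nat by rewrite inordK //; lia.
have vb : (inord t : 'I_n.+1) = t :> nat by rewrite inordK.
pose a : 'I_n.+1 := inord t.-1; pose b : 'I_n.+1 := inord t.
have ab : a != b by rewrite -val_eqE /= va vb; lia.
apply: regular_cons; first by apply: (nzd_monideal hL Lt); rewrite va vb; lia.
pose h (i : 'I_n.+1) := if i == a then b else i.
have -> : adj (monideal L) (link K n t) =
    fun p => monideal (up (pushed h L)) (glue K h p) by exact: adj_monideal_glue.
have hK i : h (h i) = h i.
  by rewrite /h; case: (i =P a) => [_|/eqP/negbTE ->//]; rewrite eq_sym (negbTE ab).
have tts s : s \in ts -> (t < s)%N.
  by move: sts; rewrite /= (path_sortedE ltn_trans) => /andP [/allP H _] /H.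
have hlt s : (t < s)%N -> forall i, (h i < s)%N = (i < s)%N.
  by move=> ts' i; rewrite /h; case: eqP => // ->; rewrite va vb; lia.
apply: (regular_preim (tau := glue K h)).
- exact: monideal_ideal (@upset_up _ _).
- move=> p; rewrite [glue K h p]glueE rmorph_sum; apply: eq_bigr => m _.
  by rewrite -!mul_mpolyC rmorphM /= glueX push_id // /glue /= comp_mpolyC.
- by move=> p; apply: up_pushed_stable.
- move=> _ /mapP [s /[dup] sin /tts ts' ->]; rewrite /link rmorphB !glueXU.
  have [|/andP [_ sn] _] := Lts s; first by rewrite inE sin orbT.
  (* Gluing moves only the index [t.-1], so it fixes every later link. *)
  have hs (i : nat) : (t <= i <= n)%N -> h (inord i) = inord i.
    move=> /andP [ti in_]; rewrite /h; case: eqP => // /(congr1 val) /=.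
    by rewrite va inordK; lia.
  by rewrite !hs //; lia.
- apply: IH; first exact: upset_up.
    exact: path_sorted sts.
  move=> s sin; have [|? Ls] := Lts s; first by rewrite inE sin orbT.
  split=> //.
  by apply: split_at_up_pushed => //; apply: hlt; apply: tts.
Qed.

(** * Partial degrees *)

(* Exponents are moved across the links x_(i-1) ~ x_i from left to right; the
   surplus a - b pending at i is the difference of the partial sums, hence
   vanishes where there is no link. *)
Lemma prod_congr_links (R : comNzRingType) (Q : R -> Prop) (x : nat -> R)
    (u v : nat -> nat) n : is_ideal Q ->
    (forall i, (0 < i < n)%N ->
      (\sum_(j < i) u j = \sum_(j < i) v j)%N \/ Q (x i.-1 - x i)) ->
    (\sum_(j < n) u j = \sum_(j < n) v j)%N ->
  Q (\prod_(j < n) x j ^+ u j - \prod_(j < n) x j ^+ v j).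
Proof.
move=> hQ links; have [Q0 QD QM] := hQ.
case: n => [|n] in links * => uv; first by rewrite !big_ord0 subrr.
suff H i : (i <= n)%N -> forall a b,
    (\sum_(j < i.+1) u j + a = \sum_(j < i.+1) v j + b)%N ->
    Q (\prod_(j < i.+1) x j ^+ u j * x i ^+ a - \prod_(j < i.+1) x j ^+ v j * x i ^+ b).
  by have := H n (leqnn n) 0%N 0%N; rewrite uv !expr0 !mulr1; apply.
elim: i => [|i IH] lin a b.
  by rewrite !big_ord_recr !big_ord0 /= !add0n !mul1r -!exprD => ->; rewrite subrr.
rewrite big_ord_recr [in RHS]big_ord_recr /= => uvab.
rewrite big_ord_recr [in X in _ - X]big_ord_recr /= -!mulrA -!exprD.
have [eq_uv | Qlink] := links i.+1 lin.
  have -> : (u i.+1 + a = v i.+1 + b)%N.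
    by apply/eqP; rewrite -(eqn_add2l (\sum_(j < i.+1) u j)) addnA uvab -addnA eq_uv.
  have := IH (ltnW lin) 0%N 0%N; rewrite !expr0 !mulr1 eq_uv => /(_ erefl) QUV.
  by apply: is_ideal_congrM => //; rewrite subrr.
have := IH (ltnW lin) (u i.+1 + a)%N (v i.+1 + b)%N.
rewrite !addnA => /(_ uvab); rewrite /= in Qlink.
set U := \prod_(j < _) _; set V := \prod_(j < _) _ => QUV.
have Qpow c : Q (x i.+1 ^+ c - x i ^+ c).
  apply: is_ideal_congrX => //.
  have -> : x i.+1 - x i = - 1 * (x i - x i.+1) by ring.
  exact: QM.
set c := (u i.+1 + a)%N in QUV *; set e := (v i.+1 + b)%N in QUV *.
have -> : U * x i.+1 ^+ c - V * x i.+1 ^+ e = (U * x i ^+ c - V * x i ^+ e) +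
    (U * (x i.+1 ^+ c - x i ^+ c) + (- V) * (x i.+1 ^+ e - x i ^+ e)) by ring.
by apply: (QD) => //; apply: (QD); apply: (QM).
Qed.

Section PartialSums.
Variable n : nat.
Implicit Types (u v m : 'X_{1..n.+1}) (i t : nat).

Definition psum u i := (\sum_(j < n.+1 | (j < i)%N) u j)%N.

Lemma psum_inord u i : (i <= n.+1)%N -> psum u i = (\sum_(j < i) u (inord j))%N.
Proof.
move=> lin; rewrite (big_ord_widen _ (fun j => u (inord j)) lin).
by apply: eq_bigr => j _; rewrite inord_val.
Qed.

Lemma psumD u v i : psum (u + v) i = (psum u i + psum v i)%N.
Proof. by rewrite /psum -big_split; apply: eq_bigr => j _; rewrite mnmDE. Qed.

Lemma psumU (a : 'I_n.+1) i : psum U_(a) i = (a < i)%N.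
Proof.
rewrite /psum; case: ltnP => ai.
  rewrite (bigD1 a) //= mnm1E eqxx big1 // => j /andP [_ ja].
  by rewrite mnm1E eq_sym (negbTE ja).
by rewrite big1 // => j ji; rewrite mnm1E; case: eqP ji => // <-; rewrite ltnNge ai.
Qed.

Lemma psum_mix t u v i : psum u t = psum v t ->
  psum (mix t u v) i = if (i <= t)%N then psum u i else psum v i.
Proof.
move=> uvt; case: leqP => it.
  by apply: eq_bigr => j ji; rewrite mixE (leq_trans ji it).
have psplit w : psum w i = (psum w t + \sum_(j < n.+1 | (j < i) && ~~ (j < t)) w j)%N.
  rewrite /psum (bigID (fun j : 'I_n.+1 => (j < t)%N)) /=; congr addn.
  apply: eq_bigl => j; apply/andP/idP => [[] //|jt]; split=> //.
  exact: ltn_trans it.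
rewrite (psplit v) (psplit (mix t u v)) -uvt; congr addn.
  by apply: eq_bigr => j jt; rewrite mixE jt.
by apply: eq_bigr => j /andP [_ /negbTE jt]; rewrite mixE jt.
Qed.

Definition of_psum (S : nat -> nat) : 'X_{1..n.+1} :=
  [multinom (S j.+1 - S j)%N | j < n.+1].

Lemma psum_of_psum (S : nat -> nat) i : S 0%N = 0%N ->
    (forall j, (j <= n)%N -> (S j <= S j.+1)%N) ->
  (i <= n.+1)%N -> psum (of_psum S) i = S i.
Proof.
move=> S0 Smono lin; rewrite psum_inord //.
elim: i lin => [|i IH] lin; first by rewrite big_ord0 S0.
rewrite big_ord_recr /= IH; last exact: ltnW.
by rewrite mnmE inordK // subnKC // Smono.
Qed.

Lemma mpolyX_congr_links (K : fieldType) (Q : {mpoly K[n.+1]} -> Prop) u v :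
    is_ideal Q ->
    (forall i, (0 < i <= n)%N -> psum u i = psum v i \/ Q (link K n i)) ->
    psum u n.+1 = psum v n.+1 ->
  Q ('X_[u] - 'X_[v]).
Proof.
move=> hQ links uv.
have XE w : 'X_[w] = \prod_(j < n.+1) ('X_(inord j) : {mpoly K[n.+1]}) ^+ w (inord j).
  by rewrite mpolyXE_id; apply: eq_bigr => j _; rewrite inord_val.
rewrite !XE; apply: (@prod_congr_links _ Q (fun j => 'X_(inord j))
  (fun j => u (inord j)) (fun j => v (inord j))) => //.
  move=> i lin; have [uvi|Qi] := links i lin; [left|by right].
  by rewrite -!psum_inord //; case/andP: lin => _ /ltnW.
by rewrite -!psum_inord.
Qed.

(** Sending all variables to one ['X] kills the links and maps every generator to ['X^d], while the
    image of ['X_[w]] has degree below [d]. *)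
Lemma mpolyX_notin (K : fieldType) (L : 'X_{1..n.+1} -> Prop) ts w d :
    (forall u, L u -> psum u n.+1 = d) -> (psum w n.+1 < d)%N ->
  ~ adjs (monideal (up L)) (map (@link K n) ts) 'X_[w].
Proof.
move=> Ld wd.
pose phi : {rmorphism {mpoly K[n.+1]} -> {poly K}} := mmap (@polyC K) (fun=> 'X).
pose D p := exists q, phi p = q * 'X^d.
have phiX m : phi 'X_[m] = 'X^(psum m n.+1).
  rewrite /phi /= mmapX /mmap1 /psum expr_sum.
  by apply: eq_bigl => j; rewrite ltn_ord.
have hD : is_ideal D.
  split=> [|p q [p' Dp] [q' Dq]|c p [p' Dp]].
  - by exists 0; rewrite rmorph0 mul0r.
  - by exists (p' + q'); rewrite rmorphD Dp Dq mulrDl.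
  - by exists (phi c * p'); rewrite rmorphM Dp mulrA.
have DI p : monideal (up L) p -> D p.
  rewrite -ideal_gen_monomial; apply: ideal_gen_sub => // _ [u [Lu ->]].
  by exists 1; rewrite phiX Ld // mul1r.
have Dlink t : phi (link K n t) = 0.
  by rewrite /link rmorphB !phiX !psumU !ltn_ord subrr.
have DA p : adjs (monideal (up L)) (map (@link K n) ts) p -> D p.
  elim: ts (monideal _) DI p => [|t ts IH] I DI p; first exact: DI.
  apply: IH => q [c /DI [r]]; rewrite rmorphB rmorphM Dlink mulr0 subr0 => Dq.
  by exists r.
move=> /DA [q]; rewrite phiX => /(congr1 (fun p : {poly K} => p`_(psum w n.+1))).
by rewrite coefXn eqxx coefMXn wd => /eqP; rewrite oner_eq0.
Qed.

End PartialSums.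

(** * Left PLP-polymatroidal ideals *)

Section LeftPLP.
Variables (n k d : nat) (b alpha beta : nat -> nat).
Hypothesis hdata : left_plp_data n.+1 k d b alpha beta.
Hypothesis hbeta : (0 < beta (k + 1))%N.

Let plp_exp := @left_plp_exponent n.+1 k b alpha beta.

(** An increasing list, as [regular_links] requires. There are [n.+1] variables here, so the last
    candidate index is [n]. *)
Definition tight := [seq t <- iota 0 n.+1 | (k + 1 <= t <= n)%N & alpha t == beta t].

Lemma mem_tight t :
  (t \in tight) = [&& k + 1 <= t, t <= n & alpha t == beta t]%N.
Proof.
rewrite mem_filter mem_iota -andbA; case: (alpha t == beta t); rewrite ?andbF //=.
by lia.
Qed.

Lemma left_plp_kn : (1 <= k <= n)%N.
Proof. by case: hdata => _ _ + _ _ _ _ _ _; lia. Qed.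

Lemma beta_le_d i : (k + 1 <= i <= n.+1)%N -> (beta i <= d)%N.
Proof.
case: (hdata) => _ _ _ _ _ _ _ bmono bn.
move: {2}(n.+1 - i)%N (erefl (n.+1 - i)%N) => l; elim: l i => [|l IH] i il ki.
  by rewrite -bn (_ : i = n.+1) //; lia.
by apply: leq_trans (bmono i _) (IH i.+1 _ _); lia.
Qed.

(** Equality of the bounds fixes the partial degree at [t] of every generator, so two generators can
    be joined there. *)
Lemma split_at_tight t : t \in tight -> split_at t (up plp_exp).
Proof.
rewrite mem_tight => /and3P [kt tn /eqP ab].
move=> m1 m2 [u1 [b1 s1] le1] [u2 [b2 s2] le2].
have u12 : psum u1 t = psum u2 t.
  have := s1 t; have := s2 t; rewrite -/(psum u1 t) -/(psum u2 t) => h1 h2.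
  by have := h1 ltac:(lia); have := h2 ltac:(lia); lia.
exists (mix t u1 u2); last first.
  apply/mnm_lepP => i; rewrite !mixE.
  by case: ifP => _; [apply: (mnm_lepP le1) | apply: (mnm_lepP le2)].
split=> [j jk|i ki].
  by rewrite mixE; case: ifP => _; [apply: b1 | apply: b2].
rewrite -/(psum _ i) psum_mix //.
by case: ifP => _; [apply: s1 | apply: s2].
Qed.

Definition socle_psum j := if (j <= k)%N then 0%N else minn (alpha j) (d - 1).

(* Partial degrees of the generator of I congruent to x_(a+1) w; the indices
   of the partial degrees are 1-based, a is 0-based. *)
Definition generator_psum a j :=
  if (j <= k)%N then nat_of_bool (a < j)%N
  else if (j <= a)%N then alpha j else minn (alpha j).+1 (beta j).

Lemma psum_socle i : (i <= n.+1)%N ->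
  psum (@of_psum n socle_psum) i = socle_psum i.
Proof.
move=> lin; apply: psum_of_psum => // j jn; rewrite /socle_psum.
case: (leqP j k) => // kj; rewrite (leqNgt j.+1) ltnS (ltnW kj) /=.
by case: (hdata) => _ _ _ _ _ amono _ _ _; have := amono j ltac:(lia); lia.
Qed.

Lemma psum_generator a i : (i <= n.+1)%N ->
  psum (@of_psum n (generator_psum a)) i = generator_psum a i.
Proof.
move=> lin; apply: psum_of_psum => // j jn; rewrite /generator_psum.
case: (hdata) => _ _ _ _ ab amono _ bmono _.
have kn := left_plp_kn; have [jk|kj|->] := ltngtP j k.
- by lia.
- have := amono j ltac:(lia); have := bmono j ltac:(lia); have := ab j ltac:(lia).
  have := ab j.+1 ltac:(lia).
  by case: (leqP j a) (leqP j.+1 a) => [ja [ja'|ja']|ja [ja'|ja']]; lia.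
(* Positivity of [beta (k + 1)] enters here: the partial degree at [k] can already be 1. *)
- have := hbeta; rewrite addn1 => hb; have := ab k.+1 ltac:(lia).
  by case: (leqP k.+1 a); lia.
Qed.

Lemma generator_plp (a : 'I_n.+1) : plp_exp (of_psum n (generator_psum a)).
Proof.
have [k0 kn] := andP left_plp_kn.
case: (hdata) => _ _ _ bpos ab _ _ _ _.
split=> [j jk|i ki]; last first.
  rewrite -/(psum _ i) psum_generator /generator_psum; last by lia.
  have := ab i ki; rewrite ifN; last by lia.
  by case: (leqP i a); lia.
(* Among the first [k] variables only the one of index [a] can occur, with exponent 1, within the
   positive bounds [b]. *)
rewrite mnmE /generator_psum jk (ltnW jk).
have := bpos j.+1 ltac:(lia).
by case: (a < j.+1)%N; case: (a < j)%N => /=; lia.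
Qed.

(** At a non-tight [i] with k < i <= n one has alpha_i < beta_i <= d, so neither minimum truncates;
    at [n.+1] both sides equal [d]. *)
Lemma socle_generator_psum (a : 'I_n.+1) i : (0 < i <= n.+1)%N -> i \notin tight ->
  psum (of_psum n socle_psum + U_(a)) i = psum (of_psum n (generator_psum a)) i.
Proof.
move=> /andP [i0 lin]; rewrite mem_tight => it.
rewrite psumD psumU psum_socle // psum_generator //.
rewrite /socle_psum /generator_psum; case: (leqP i k) => ki; first by rewrite add0n.
case: (hdata) => _ d0 _ _ ab _ an _ bn.
have := ab i ltac:(lia); have := beta_le_d (i := i) ltac:(lia).
have an' := ltn_ord a; case: (leqP i a) => ia.
  by move: it; case: eqP; lia.
have [iE|iN] := eqVneq i n.+1; first by rewrite iE an bn; lia.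
by move: it; case: eqP; lia.
Qed.

Lemma left_plp_depth (K : fieldType) :
  depth_is (@left_plp_ideal K n.+1 k b alpha beta) (size tight).
Proof.
have [k0 kn] := andP left_plp_kn.
case: (hdata) => _ d0 _ _ _ _ an _ bn.
rewrite /depth_is /left_plp_ideal ideal_gen_monomial -/plp_exp.
have hI := @monideal_ideal K _ _ (@upset_up _ plp_exp).
set I := monideal _ in hI *; pose J := @irrelevant_ideal K n.+1.
have hJ : is_ideal J := ideal_gen_ideal _.
pose gs := map (@link K n) tight.
have Jgs f : f \in gs -> J f.
  by move=> /mapP [t _ ->]; apply: is_idealB => //; apply: ideal_gen_mem; eexists.
have Igs : regular I gs.
  apply: regular_links; first exact: upset_up.
    by apply: sorted_filter; [apply: ltn_trans | apply: iota_ltn_sorted].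
  move=> t tt; split; last exact: split_at_tight.
  by move: tt; rewrite mem_tight; lia.
pose w := of_psum n socle_psum.
have hQ := adjs_ideal gs hI.
have Iw : ~ adjs I gs 'X_[w].
  apply: (mpolyX_notin (d := d)) => [u [_ /(_ n.+1)]|].
    by rewrite an bn => /(_ ltac:(lia)); rewrite -/(psum u n.+1); lia.
  by rewrite psum_socle // /socle_psum an; case: (leqP n.+1 k); lia.
have Jw f : J f -> adjs I gs (f * 'X_[w]).
  move=> [m [c [x [xX ->]]]]; rewrite mulr_suml; apply: is_ideal_sum => // i _.
  have [a ->] := xX i; rewrite -mulrA -mpolyXD addmC.
  case: (hQ) => _ _; apply.
  pose u := of_psum n (generator_psum a).
  apply: (is_ideal_subr (b := 'X_[u])) => //; last first.
    apply: adjs_sub; apply/monidealX; exists u; last exact: lepm_refl.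
    exact: generator_plp.
  apply: mpolyX_congr_links => // [i' lin|].
    have [it|it] := boolP (i' \in tight); [right|left].
      by apply: adjs_mem => //; apply: map_f.
    by apply: socle_generator_psum => //; lia.
  (* The index [n.+1] is never tight, so the total degrees agree. *)
  by apply: socle_generator_psum; rewrite ?mem_tight; lia.
split.
  exists gs; split=> //; last by rewrite size_map.
  (* If 1 were in the enlarged ideal, so would be ['X_[w]]. *)
  apply/regular_on_quotientE => //; split=> // I1; apply: Iw.
  by rewrite -['X_[w]]mulr1; case: hQ => _ _; apply.
move=> s Js /(regular_on_quotientE s hI) [Is _].
apply: (regular_size_le (J := J) hI _ Js Jgs Is Igs) Iw Jw.
  by case: hJ.
by rewrite size_map.
Qed.

Lemma card_tight :
  #|[set i : 'I_n.+1 | (k + 1 <= i <= n.+1 - 1)%N && (alpha i == beta i)]| = size tight.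
Proof.
rewrite cardsE cardE /tight -val_enum_ord filter_map size_map {1}/enum_mem -enumT.
by congr size; apply: eq_filter => i; rewrite /= unfold_in /= subn1.
Qed.

End LeftPLP.

Theorem proposition5p2 (K : fieldType) (n k d : nat)
    (b alpha beta : nat -> nat)
    (hdata : left_plp_data n k d b alpha beta)
    (hbeta : (0 < beta (k + 1))%N) :
  depth_is (@left_plp_ideal K n k b alpha beta)
    #|[set i : 'I_n | (k + 1 <= i <= n - 1)%N && (alpha i == beta i)]|.
Proof.
case: n hdata => [|n] hdata; first by case: hdata.
by rewrite card_tight; apply: left_plp_depth hdata hbeta K.
Qed.
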